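(* Let $k\ge1$, $R_k=\mathbb F_2[u_1,\ldots,u_k]/\langle u_i^2,\ u_iu_j-u_ju_i\rangle$, $\ell=|R_k|=2^{2^k}$, let $b,n,t\ge1$ be integers, and let $C\subseteq R_k^{bn}$ be a byte error-control code (linear code) with byte length $b$. For each composition vector $\mathbf J=(\mathbf J_1,\ldots,\mathbf J_n)$ let $A(\mathbf J)$ be the number of codewords of $C$ with composition vector $\mathbf J$. Then the $m$-spotty Lee weight enumerator of the dual code $C^\perp$ is $$L_{C^\perp}(z)=\frac1{|C|}\sum_{\mathbf J}A(\mathbf J)\prod_{i=1}^n g^{(t)}_{\mathbf J_i}(z),$$ where the sum runs over all $n$-tuples $\mathbf J=(\mathbf J_1,\ldots,\mathbf J_n)$ with each $\mathbf J_i$ an $\ell$-tuple over $\{0,1,\ldots,b\}$, and $g^{(t)}_{\mathbf J_i}$ is the polynomial defined in the context.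
   Context: Every element of $R_k$ is uniquely $\sum_{A\subseteq\{1,\ldots,k\}}c_Au_A$ with $c_A\in\mathbb F_2$, $u_A=\prod_{i\in A}u_i$, $u_\emptyset=1$. The character $\chi:R_k\to\mathbb C^\times$ is $\chi\bigl(\sum_A c_Au_A\bigr)=(-1)^{\mathrm{wt}((c_A)_A)}$, where $\mathrm{wt}$ is the number of $A$ with $c_A\ne0$. Lee weight: $w_L:R_k\to\mathbb Z_{\ge0}$ is the Hamming weight of the Gray image, $w_L(r)=\mathrm{wt}_H(\varphi_k(r))$, where $\varphi_0:\mathbb F_2\to\mathbb F_2$ is the identity and $\varphi_k:R_k=R_{k-1}+u_kR_{k-1}\to\mathbb F_2^{2^k}$ is $\varphi_k(a+u_kc)=(\varphi_{k-1}(c),\varphi_{k-1}(a)+\varphi_{k-1}(c))$ for $a,c\in R_{k-1}$. In particular $w_L(0)=0$ and $w_L(u_A)=2^{|A|}$. For $\mathbf x\in R_k^b$, $w_L(\mathbf x)=\sum_{j=1}^b w_L(x_j)$. A byte error-control code of length $bn$ and byte length $b$ is an $R_k$-submodule of $R_k^{bn}$; vectors are $\mathbf u=(\mathbf u_1,\ldots,\mathbf u_n)$ with bytes $\mathbf u_i\in R_k^b$. $C^\perp$ is the dual for the Euclidean inner product. The $m$-spotty Lee weight is $w_{ML}(\mathbf u)=\sum_{i=1}^n\lceil w_L(\mathbf u_i)/t\rceil$, and the $m$-spotty Lee weight enumerator of a code $C$ is $L_C(z)=\sum_{\mathbf u\in C}z^{w_{ML}(\mathbf u)}$. Fix an enumeration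 $R_k=\{r_0,r_1,\ldots,r_{\ell-1}\}$ with $r_0=0$. The composition of a byte $\mathbf u_i$ is $\mathbf J_i=(j_{i0},\ldots,j_{i,\ell-1})$, where $j_{ip}$ is the number of coordinates of $\mathbf u_i$ equal to $r_p$; the composition vector of $\mathbf u$ is $\mathbf J=(\mathbf J_1,\ldots,\mathbf J_n)$. For an $\ell$-tuple $\mathbf j=(j_0,\ldots,j_{\ell-1})$ of nonnegative integers, $$g^{(t)}_{\mathbf j}(z)=\sum_{(s_{pq})}\left(\prod_{p=0}^{\ell-1}\frac{j_p!}{\prod_{q=0}^{\ell-1}s_{pq}!}\,\chi\Bigl(\sum_{q=0}^{\ell-1}r_pr_qs_{pq}\Bigr)\right)z^{\left\lceil \frac1t\sum_{p=0}^{\ell-1}\sum_{q=1}^{\ell-1}w_L(r_q)s_{pq}\right\rceil},$$ where the sum runs over all families of nonnegative integers $s_{pq}$ ($0\le p,q\le\ell-1$) with $\sum_{q=0}^{\ell-1}s_{pq}=j_p$ for every $p$. *)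

(* Defs.v *)
From HB Require Import structures.
From mathcomp Require Import all_boot all_order all_algebra.
From mathcomp Require Import mpoly.

Set Implicit Arguments.
Unset Strict Implicit.
Unset Printing Implicit Defensive.

Import Order.TTheory GRing.Theory Num.Theory.

Local Open Scope ring_scope.

(* R_k = F_2[u_1, ..., u_k] / (u_i^2), on the basis of the square-free
   monomials u_A: an element is its family of coefficients (c_A)_A, and the
   product is the bilinear one with u_B * u_D = u_(B :|: D) when B and D are
   disjoint, and 0 otherwise.  The lemmas Rk_presentation_onto and
   Rk_presentation_ker below show that this is the quotient of the polynomial
   ring. *)
Definition Rk (k : nat) : Type := {ffun {set 'I_k} -> 'F_2}.

HB.instance Definition _ k := Finite.copy (Rk k) {ffun {set 'I_k} -> 'F_2}.
HB.instance Definition _ k :=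
  GRing.Zmodule.copy (Rk k) {ffun {set 'I_k} -> 'F_2}.

Section RkRing.

Variable k : nat.
Implicit Types (f g h : Rk k) (A B D : {set 'I_k}).

Definition coefR f A : 'F_2 := (f : {ffun {set 'I_k} -> 'F_2}) A.

Definition basisR A : Rk k := [ffun B => (B == A)%:R].

Definition mulR f g : Rk k :=
  [ffun A : {set 'I_k} =>
     \sum_(B : {set 'I_k} | B \subset A) coefR f B * coefR g (A :\: B)].

Lemma RkP f g : (forall A, coefR f A = coefR g A) -> f = g.
Proof. by move=> fg; apply/ffunP. Qed.

Lemma coefR_mul f g A :
  coefR (mulR f g) A =
  \sum_(B : {set 'I_k} | B \subset A) coefR f B * coefR g (A :\: B).
Proof. by rewrite /coefR ffunE. Qed.

Lemma coefRD f g A : coefR (f + g) A = coefR f A + coefR g A.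
Proof. by rewrite /coefR ffunE. Qed.

Lemma coefR_basis A B : coefR (basisR A) B = (B == A)%:R.
Proof. by rewrite /coefR ffunE. Qed.

Fact mulR_comm : commutative mulR.
Proof.
move=> f g; apply/RkP => A; rewrite !coefR_mul.
rewrite (reindex_onto (fun B => A :\: B) (fun B => A :\: B)) /=; last first.
  by move=> B sBA; rewrite setDDr setDv set0U; apply/setIidPr.
apply: eq_big => [B|B].
  rewrite subsetDl /= setDDr setDv set0U.
  by apply/eqP/idP => [<-|/setIidPr //]; rewrite subsetIl.
by move=> /andP[_ /eqP ->]; rewrite mulrC.
Qed.

Fact mulR_1 : left_id (basisR set0) mulR.
Proof.
move=> f; apply/RkP => A; rewrite coefR_mul (bigD1 set0) ?sub0set //=.
rewrite coefR_basis eqxx mul1r setD0 big1 ?addr0 // => B /andP[_ /negPf B0].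
by rewrite coefR_basis B0 mul0r.
Qed.

Fact mulR_Dl : left_distributive mulR +%R.
Proof.
move=> f g h; apply/RkP => A; rewrite coefRD !coefR_mul -big_split /=.
by apply: eq_bigr => B _; rewrite coefRD mulrDl.
Qed.

Fact mulR_assoc : associative mulR.
Proof.
move=> f g h; apply/RkP => A; rewrite !coefR_mul.
transitivity (\sum_(B : {set 'I_k} | B \subset A)
    \sum_(D : {set 'I_k} | B \subset D)
      if D \subset A then
        coefR f B * (coefR g (D :\: B) * coefR h (A :\: D)) else 0).
  apply: eq_bigr => B sBA; rewrite coefR_mul mulr_sumr -big_mkcondr /=.
  rewrite (reindex_onto (fun D => D :\: B) (fun D => D :|: B)) /=; last first.
    move=> E; rewrite subsetD => /andP[_ dEB].
    by rewrite setDUl setDv setU0; apply/setDidPl.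
  apply: eq_big => [D|D /andP[_ /eqP e]]; last first.
    have sBD : B \subset D by rewrite -e subsetUr.
    congr (_ * (_ * coefR h _)); apply/setP => i; rewrite !inE.
    by case: (boolP (i \in B)) => [/(subsetP sBD) ->|_] //=; rewrite ?andbT.
  apply/andP/andP => [[sDA /eqP e]|[sBD sDA]].
    split; first by rewrite -e subsetUr.
    by rewrite -e subUset sBA andbT (subset_trans sDA) ?subsetDl.
  split; first by apply: setSD.
  by apply/eqP/setP => i; rewrite !inE;
     case: (boolP (i \in B)) => [/(subsetP sBD) ->|]; rewrite ?orbF.
rewrite (exchange_big_dep xpredT) //=.
rewrite [RHS]big_mkcond /=; apply: eq_bigr => D _.
case: ifP => sDA; last by rewrite big1.
rewrite coefR_mul mulr_suml; apply: eq_big => [B|B _]; last by rewrite mulrA.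
by apply: andb_idl => sBD; apply: subset_trans sBD sDA.
Qed.

Fact oneR_neq0 : basisR set0 != 0.
Proof.
apply/eqP => /(congr1 (coefR^~ set0)); rewrite coefR_basis eqxx.
by rewrite /coefR ffunE.
Qed.

End RkRing.

HB.instance Definition _ k := GRing.Zmodule_isComNzRing.Build (Rk k)
  (@mulR_assoc k) (@mulR_comm k) (@mulR_1 k) (@mulR_Dl k) (@oneR_neq0 k).

Definition uvar k (i : 'I_k) : Rk k := basisR [set i].

Section RkTheory.

Variable k : nat.
Implicit Types (f g : Rk k) (A B : {set 'I_k}).

Lemma coefRM f g A :
  coefR (f * g) A =
  \sum_(B : {set 'I_k} | B \subset A) coefR f B * coefR g (A :\: B).
Proof. exact: coefR_mul. Qed.

Lemma coefR0 A : coefR (0 : Rk k) A = 0.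
Proof. by rewrite /coefR ffunE. Qed.

Lemma coefR_sum I (s : seq I) (P : pred I) (F : I -> Rk k) A :
  coefR (\sum_(i <- s | P i) F i) A = \sum_(i <- s | P i) coefR (F i) A.
Proof.
exact: (big_morph (fun f => coefR f A) (fun f g => coefRD f g A) (coefR0 A)).
Qed.

Lemma card_Rk : #|{: Rk k}| = (2 ^ 2 ^ k)%N.
Proof. by rewrite card_ffun card_Fp // -cardsT -powersetT card_powerset cardsT
  card_ord. Qed.

Lemma basisRM A B :
  basisR A * basisR B = (if [disjoint A & B] then basisR (A :|: B) else 0).
Proof.
apply/RkP => D; rewrite coefRM.
have -> : coefR (if [disjoint A & B] then basisR (A :|: B) else 0) D =
  ([disjoint A & B] && (D == A :|: B))%:R.
  by case: ifP => _; rewrite ?coefR_basis ?coefR0.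
rewrite big_mkcond (bigD1 A) //= big1 ?addr0 => [|E nEA]; last first.
  by rewrite coefR_basis (negPf nEA) mul0r; case: ifP.
rewrite !coefR_basis eqxx mul1r.
have -> : [disjoint A & B] && (D == A :|: B) = (A \subset D) && (D :\: A == B).
  apply/andP/andP => [[dAB /eqP ->]|[sAD /eqP <-]].
    split; first exact: subsetUl.
    by rewrite setDUl setDv set0U; apply/eqP/setDidPl; rewrite disjoint_sym.
  rewrite -setI_eq0 setDE setICA setICr setI0 eqxx; split=> //.
  apply/eqP/setP => i; rewrite !inE.
  by case: (boolP (i \in A)) => [/(subsetP sAD) ->|_] /=; rewrite ?andbT.
by case: (A \subset D).
Qed.

Lemma basisR0 : basisR set0 = 1 :> Rk k.
Proof. by []. Qed.

Lemma uvar_sq (i : 'I_k) : uvar i ^+ 2 = 0.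
Proof. by rewrite expr2 basisRM -setI_eq0 setIid -cards_eq0 cards1. Qed.

Lemma basisR_prod A : basisR A = \prod_(i in A) uvar i.
Proof.
elim: {A}#|A| {-2}A (erefl #|A|) => [|n IHn] A cA.
  by move/eqP: cA; rewrite cards_eq0 => /eqP ->; rewrite big_set0.
have [i iA] : exists i, i \in A by apply/card_gt0P; rewrite cA.
rewrite (big_setD1 i) //= -IHn; last by move: cA; rewrite (cardsD1 i) iA => -[].
by rewrite basisRM disjoints1 !inE eqxx /= setD1K.
Qed.

Lemma Rk_expand f : f = \sum_(A : {set 'I_k}) basisR A *+ coefR f A.
Proof.
have F2E (c : 'F_2) : c = (c : nat)%:R by rewrite natr_Zp.
apply/RkP => A; rewrite coefR_sum (bigD1 A) //= big1 ?addr0 => [|B nBA].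
  by case: (coefR f A) => [[|[|//]] ?] /=; rewrite ?mulr0n ?mulr1n ?coefR0 ?coefR_basis
    ?eqxx; apply/val_inj.
by case: (coefR f B) => [[|[|//]] ?] /=; rewrite ?mulr0n ?mulr1n ?coefR0
  ?coefR_basis // eq_sym (negPf nBA).
Qed.

End RkTheory.

Section Presentation.

Variable k : nat.

Definition scalR (c : 'F_2) : Rk k :=
  [ffun A : {set 'I_k} => if A == set0 then c else 0].

Lemma coefR_scalM c (f : Rk k) A : coefR (scalR c * f) A = c * coefR f A.
Proof.
rewrite coefRM (bigD1 set0) ?sub0set //= big1 => [|B /andP[_ /negPf B0]].
  by rewrite /coefR ffunE eqxx setD0 addr0.
by rewrite /coefR ffunE B0 mul0r.
Qed.

Fact scalR_additive : additive scalR.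
Proof.
move=> c d; apply/RkP => A; rewrite /coefR !ffunE.
by case: ifP => _; rewrite ?subr0.
Qed.

Fact scalR_multiplicative : multiplicative scalR.
Proof.
split=> [c d|]; apply/RkP => A.
  by rewrite coefR_scalM /coefR !ffunE; case: ifP; rewrite ?mulr0.
by rewrite -basisR0 coefR_basis /coefR ffunE; case: ifP.
Qed.

HB.instance Definition _ :=
  GRing.isAdditive.Build 'F_2 (Rk k) scalR scalR_additive.
HB.instance Definition _ :=
  GRing.isMultiplicative.Build 'F_2 (Rk k) scalR scalR_multiplicative.

Definition Rk_eval : {rmorphism {mpoly 'F_2[k]} -> Rk k} :=
  mmap scalR (@uvar k).

Let mset (A : {set 'I_k}) : 'X_{1..k} := [multinom (i \in A : nat) | i < k].

Lemma Rk_evalX m A : coefR (mmap1 (@uvar k) m) A = (m == mset A)%:R.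
Proof.
have [sqm|/forallPn[i]] := boolP [forall i, m i <= 1]%N; last first.
  rewrite -ltnNge => mi; rewrite /mmap1 (bigD1 i) //= -(subnK mi) addnC exprD.
  rewrite uvar_sq !mul0r coefR0; case: eqP => // mE.
  by move: mi; rewrite mE mnmE; case: (i \in A).
pose B := [set i | m i == 1%N].
have mE : m = mset B.
  apply/mnmP => i; rewrite mnmE inE.
  by move/forallP/(_ i): sqm; case: (m i) => [|[]].
have -> : mmap1 (@uvar k) m = basisR B.
  rewrite basisR_prod /mmap1 [RHS]big_mkcond /=; apply: eq_bigr => i _.
  by rewrite {1}mE mnmE; case: (i \in B).
rewrite coefR_basis {1}mE; congr (_%:R); congr (nat_of_bool _).
apply/eqP/eqP => [->//|e]; apply/setP => i.
by move/mnmP/(_ i): e; rewrite !mnmE; do 2!case: (i \in _).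
Qed.

Lemma coefR_eval p A : coefR (Rk_eval p) A = p@_(mset A).
Proof.
rewrite /= /mmap coefR_sum [in RHS](mpolyE p) linear_sum /=.
by apply: eq_bigr => m _; rewrite coefR_scalM Rk_evalX mcoeffZ mcoeffX.
Qed.

Lemma Rk_presentation_onto (f : Rk k) : exists p, Rk_eval p = f.
Proof.
have h A : exists p, Rk_eval p = basisR A.
  exists (\prod_(i in A) 'X_i); rewrite rmorph_prod basisR_prod.
  by apply: eq_bigr => i _; rewrite /= mmapX mmap1U.
rewrite [f]Rk_expand; elim/big_ind: _ => [|x y [p <-] [q <-]|A _].
- by exists 0; rewrite rmorph0.
- by exists (p + q); rewrite rmorphD.
- by have [p <-] := h A; exists (p *+ coefR f A); rewrite rmorphMn.
Qed.

Lemma Rk_presentation_ker (p : {mpoly 'F_2[k]}) :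
  Rk_eval p = 0 <->
  exists q : 'I_k -> {mpoly 'F_2[k]}, p = \sum_(i < k) q i * 'X_i ^+ 2.
Proof.
split=> [p0|[q ->]]; last first.
  rewrite rmorph_sum big1 // => i _; rewrite rmorphM rmorphXn /=.
  by rewrite [mmap _ _ 'X_i]mmapX mmap1U uvar_sq mulr0.
rewrite [p]mpolyE big_seq; elim/big_ind: _ => [|x y [q ->] [q' ->]|m mp].
- by exists (fun=> 0); rewrite big1 // => i _; rewrite mul0r.
- exists (fun i => q i + q' i); rewrite -big_split /=.
  by apply: eq_bigr => i _; rewrite mulrDl.
have [sqm|/forallPn[i]] := boolP [forall i, m i <= 1]%N.
  move: mp; rewrite mcoeff_msupp => /negP[].
  suff -> : m = mset [set i | m i == 1%N] by rewrite -coefR_eval p0 coefR0.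
  apply/mnmP => i; rewrite mnmE inE.
  by move/forallP/(_ i): sqm; case: (m i) => [|[]].
rewrite -ltnNge => mi.
exists (fun j => if j == i then p@_m *: 'X_[m - (U_(i) *+ 2)] else 0).
rewrite (bigD1 i) //= eqxx big1 ?addr0 => [|j /negPf ->]; last by rewrite mul0r.
rewrite mpolyXn -scalerAl -mpolyXD submK //.
apply/mnm_lepP => j; rewrite mulmnE mnm1E.
by case: eqP => [<-|_]; rewrite ?mul1n ?mul0n.
Qed.

End Presentation.

Section GrayMap.

Variable k : nat.

(* R_(k+1) = R_k + u_(k+1) R_k: the last variable is u_(k+1), the first k ones
   are embedded by lift ord_max (which keeps the value of the index). *)
Definition liftR (a : Rk k) : Rk k.+1 :=
  [ffun A : {set 'I_k.+1} =>
     if ord_max \in A then 0 else coefR a (lift ord_max @^-1: A)].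

Definition lowR (r : Rk k.+1) : Rk k :=
  [ffun A : {set 'I_k} => coefR r (lift ord_max @: A)].

Definition highR (r : Rk k.+1) : Rk k :=
  [ffun A : {set 'I_k} => coefR r (ord_max |: lift ord_max @: A)].

Fact max_notin_lift (A : {set 'I_k}) : ord_max \notin lift ord_max @: A.
Proof. by apply/imsetP => -[i _ /eqP]; apply/negP; apply: neq_lift. Qed.

Fact lift_preim (A : {set 'I_k}) : lift ord_max @^-1: (lift ord_max @: A) = A.
Proof. by apply/setP => i; rewrite inE mem_imset //; apply: lift_inj. Qed.

Fact lift_im (A : {set 'I_k.+1}) :
  ord_max \notin A -> lift ord_max @: (lift ord_max @^-1: A) = A.
Proof.
move=> mA; apply/setP => i; case: (unliftP ord_max i) => [j ->|->].
  by rewrite mem_imset ?inE //; apply: lift_inj.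
by rewrite (negPf mA) (negPf (max_notin_lift _)).
Qed.

Lemma coefR_lift_high (a c : Rk k) A :
  coefR (liftR a + uvar ord_max * liftR c) A =
  if ord_max \in A then coefR c (lift ord_max @^-1: A)
  else coefR a (lift ord_max @^-1: A).
Proof.
rewrite coefRD coefRM {1}/coefR ffunE.
rewrite big_mkcond (bigD1 [set ord_max]) //= big1 => [|B /negPf nB].
  rewrite coefR_basis eqxx mul1r addr0 sub1set.
  case: ifP => mA; last by rewrite addr0.
  rewrite add0r /coefR ffunE !inE eqxx /= ; congr (c _).
  by apply/setP => i; rewrite !inE eq_sym (negPf (neq_lift _ _)).
by rewrite coefR_basis nB mul0r if_same.
Qed.

Lemma Rk_decomp (r : Rk k.+1) :
  r = liftR (lowR r) + uvar ord_max * liftR (highR r).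
Proof.
apply/RkP => A; rewrite coefR_lift_high.
case: ifP => mA; rewrite {2}/coefR ffunE; last by rewrite lift_im ?mA.
congr coefR; apply/setP => i; rewrite !inE.
case: (unliftP ord_max i) => [j ->|->]; last by rewrite eqxx mA.
by rewrite eq_sym (negPf (neq_lift _ _)) mem_imset ?inE //; apply: lift_inj.
Qed.

Lemma lowR_decomp (a c : Rk k) : lowR (liftR a + uvar ord_max * liftR c) = a.
Proof.
apply/RkP => A; rewrite {1}/coefR ffunE coefR_lift_high.
by rewrite (negPf (max_notin_lift A)) lift_preim.
Qed.

Lemma highR_decomp (a c : Rk k) : highR (liftR a + uvar ord_max * liftR c) = c.
Proof.
apply/RkP => A; rewrite {1}/coefR ffunE coefR_lift_high setU11.
congr coefR; apply/setP => i; rewrite !inE eq_sym (negPf (neq_lift _ _)) /=.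
by rewrite mem_imset //; apply: lift_inj.
Qed.

End GrayMap.

Fact gray_cast k : (2 ^ k + 2 ^ k = 2 ^ k.+1)%N.
Proof. by rewrite addnn -mul2n expnS. Qed.

Fixpoint gray (k : nat) : Rk k -> 'rV['F_2]_(2 ^ k) :=
  match k with
  | 0 => fun r => const_mx (coefR r set0)
  | k'.+1 => fun r =>
      castmx (erefl, gray_cast k')
        (row_mx (gray (highR r)) (gray (lowR r) + gray (highR r)))
  end.

Lemma gray_rec k (a c : Rk k) :
  gray (liftR a + uvar ord_max * liftR c) =
  castmx (erefl, gray_cast k) (row_mx (gray c) (gray a + gray c)).
Proof. by rewrite /= lowR_decomp highR_decomp. Qed.

Definition hamming (F : nmodType) m (x : 'rV[F]_m) : nat :=
  #|[set j | x ord0 j != 0]|.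

Definition leeR k (r : Rk k) : nat := hamming (gray r).

Definition lee k b (x : 'rV[Rk k]_b) : nat := \sum_(j < b) leeR (x ord0 j).

Lemma gray0 k : gray (0 : Rk k) = 0.
Proof.
elim: k => [|k IHk] /=; first by apply/matrixP => i j; rewrite !mxE coefR0.
have -> : highR (0 : Rk k.+1) = 0.
  by apply/RkP => A; rewrite {1}/coefR ffunE !coefR0.
have -> : lowR (0 : Rk k.+1) = 0.
  by apply/RkP => A; rewrite {1}/coefR ffunE !coefR0.
rewrite IHk addr0 row_mx0.
by apply/matrixP => i j; rewrite castmxE !mxE.
Qed.

Lemma hamming0 (F : nmodType) m : hamming (0 : 'rV[F]_m) = 0%N.
Proof.
by apply/eqP; rewrite cards_eq0; apply/eqP/setP => j; rewrite !inE mxE /= eqxx.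
Qed.

Lemma hamming_cat (F : nmodType) m1 m2 m (e : (m1 + m2 = m)%N)
    (x : 'rV[F]_m1) (y : 'rV[F]_m2) :
  hamming (castmx (erefl, e) (row_mx x y)) = (hamming x + hamming y)%N.
Proof.
case: m / e; rewrite castmx_id /hamming -!sum1dep_card.
rewrite big_split_ord /=; congr addn; apply: eq_bigl => j.
  by rewrite row_mxEl.
by rewrite row_mxEr.
Qed.

Lemma leeR0 k : leeR (0 : Rk k) = 0%N.
Proof. by rewrite /leeR gray0 hamming0. Qed.

Lemma leeR_basis k (A : {set 'I_k}) : leeR (basisR A) = (2 ^ #|A|)%N.
Proof.
elim: k A => [|k IHk] A; rewrite /leeR /=.
  have -> : A = set0 by apply/setP => -[].
  rewrite cards0 /hamming; apply/eqP/cards1P; exists 0; apply/setP => j.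
  by rewrite !inE mxE coefR_basis eqxx ord1.
rewrite hamming_cat.
have [mA|mA] := boolP (ord_max \in A).
  pose B := lift ord_max @^-1: A.
  have AE : A = ord_max |: lift ord_max @: B.
    apply/setP => i; rewrite !inE; case: (unliftP ord_max i) => [j ->|->].
      rewrite eq_sym (negPf (neq_lift _ _)) mem_imset ?inE //.
      exact: lift_inj.
    by rewrite eqxx.
  have -> : highR (basisR A) = basisR B.
    apply/RkP => D; rewrite {1}/coefR ffunE !coefR_basis; congr (_%:R).
    congr nat_of_bool; apply/eqP/eqP => [e|->//].
    apply/setP => j; move/setP/(_ (lift ord_max j)): e.
    by rewrite !inE eq_sym (negPf (neq_lift _ _)) mem_imset //; apply: lift_inj.
  have -> : lowR (basisR A) = 0.
    apply/RkP => D; rewrite {1}/coefR ffunE coefR_basis coefR0.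
    by case: eqP => // e; case/negP: (max_notin_lift D); rewrite e.
  rewrite gray0 add0r addnn -mul2n [hamming _]IHk [in RHS]AE cardsU1 max_notin_lift.
  by rewrite card_imset ?expnS //; apply: lift_inj.
have -> : highR (basisR A) = 0.
  apply/RkP => D; rewrite {1}/coefR ffunE coefR_basis coefR0.
  by case: eqP => // e; move: mA; rewrite -e setU11.
have -> : lowR (basisR A) = basisR (lift ord_max @^-1: A).
  apply/RkP => D; rewrite {1}/coefR ffunE !coefR_basis; congr (_%:R).
  by congr nat_of_bool; apply/eqP/eqP => [<-|->]; rewrite ?lift_preim ?lift_im.
rewrite gray0 hamming0 addr0 [hamming _]IHk add0n -[in RHS](lift_im mA).
by rewrite card_imset //; apply: lift_inj.
Qed.

Definition chi (F : nzRingType) k (r : Rk k) : F :=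
  (-1) ^+ #|[set A : {set 'I_k} | coefR r A != 0]|.

Lemma val_mxvec_index m n (i : 'I_m) (j : 'I_n) :
  mxvec_index i j = (i * n + j)%N :> nat.
Proof.
have idx (T1 T2 : eqType) (s1 : seq T1) (s2 : seq T2) x y :
    x \in s1 -> y \in s2 ->
    index (x, y) [seq (x', y') | x' <- s1, y' <- s2] =
    (index x s1 * size s2 + index y s2)%N.
  move=> xs ys; elim: s1 xs => // a s1 IHs; rewrite inE /= index_cat.
  have [-> _|nxa /= xs] := eqVneq x a.
    by rewrite map_f // mul0n index_map // => ? ? [].
  case: ifP => [/mapP[z _ [/eqP]]|_]; first by rewrite (negPf nxa).
  by rewrite IHs // size_map mulSn addnA.
rewrite /mxvec_index /= /enum_rank enum_rank_in.unlock insubdK; last first.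
  by rewrite cardE [_ \in _]index_mem mem_enum.
rewrite enumT unlock idx ?mem_enum // -cardE card_ord.
by rewrite !index_enum_ord.
Qed.

Section Codes.

Variables (k b n : nat).
Implicit Types (u v : 'rV[Rk k]_(n * b)) (C : {set 'rV[Rk k]_(n * b)}).

(* Coordinate j of byte i is coordinate i * b + j of the vector: see byteE. *)
Definition byte u (i : 'I_n) : 'rV[Rk k]_b := row i (vec_mx u).

Lemma byteE u (i : 'I_n) (j : 'I_b) (m : 'I_(n * b)) :
  m = (i * b + j)%N :> nat -> byte u i ord0 j = u ord0 m.
Proof.
by move=> e; rewrite !mxE; congr (u _ _); apply: ord_inj; rewrite val_mxvec_index e.
Qed.

Definition edot u v : Rk k := \sum_j u 0 j * v 0 j.

Definition dual C : {set 'rV[Rk k]_(n * b)} :=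
  [set v | [forall u in C, edot u v == 0]].

Definition ceil_div (m t : nat) : nat :=
  `|Num.ceil (m%:R / t%:R : rat)|%N.

Definition spotty_lee (t : nat) u : nat :=
  \sum_(i < n) ceil_div (lee (byte u i)) t.

Definition spotty_enum (F : nzRingType) (t : nat) C : {poly F} :=
  \sum_(u in C) 'X^(spotty_lee t u).

Definition byte_comp (l : nat) (r : 'I_l -> Rk k) u (i : 'I_n) (p : 'I_l) :
  nat := #|[set j | byte u i ord0 j == r p]|.

Definition comp_count (l : nat) (r : 'I_l -> Rk k) C
    (J : 'I_n -> 'I_l -> nat) : nat :=
  #|[set u in C | [forall i, [forall p, byte_comp r u i p == J i p]]]|.

End Codes.

(* The entries s_(p, q) are at most j_p, so the families s range over a finite
   type; the constraint on the row sums then selects the intended ones. *)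
Definition gpoly (F : fieldType) k (t l : nat) (r : 'I_l -> Rk k)
    (j : 'I_l -> nat) : {poly F} :=
  \sum_(s : {ffun 'I_l -> {ffun 'I_l -> 'I_(\max_(p < l) j p).+1}}
         | [forall p, (\sum_(q < l) s p q)%N == j p])
    (\prod_(p < l) ((j p)`!%:R / (\prod_(q < l) (s p q)`!)%:R
                    * chi F (\sum_(q < l) (r p * r q) *+ s p q)))
    *: 'X^(ceil_div (\sum_(p < l) \sum_(q < l | 0 < q) leeR (r q) * s p q) t).

(* Main.v *)
Require Import Defs.
From mathcomp Require Import all_boot all_order all_algebra.
From mathcomp Require Import reals complex.

(* The additive character chi is generating: every nonzero element of R_k has a
   multiple on which chi is -1.  Hence the sum over C of chi <u, v> is |C| for v
   in the dual code and 0 otherwise, and |C| times the enumerator of the dual is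
   the sum over u in C of the Fourier transform at u of v |-> z^(w_ML v).  This
   function is a product over the bytes, and so is its transform.  The transform
   of a byte is grouped by the joint composition s_pq (the number of coordinates
   carrying r_p in the given byte and r_q in the summation variable): the summand
   depends only on s, and s is reached by prod_p (j_p! / prod_q s_pq!) bytes,
   which gives g_j(z). *)

Import GRing.Theory Num.Theory.

Local Open Scope ring_scope.

(** * Additivity of [chi] and its generating property *)

Section Character.

Variables (F : numFieldType) (k : nat).
Implicit Types (x y : Rk k).

Lemma chiE x : chi F x = \prod_(A : {set 'I_k}) (-1) ^+ (coefR x A).
Proof.
rewrite /chi -sum1_card -prodrXr big_mkcond; apply: eq_bigr => A _.
by rewrite inE; case: (coefR x A) => [[|[|//]] ?].
Qed.

Lemma chi0 : chi F (0 : Rk k) = 1.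
Proof. by rewrite chiE big1 // => A _; rewrite coefR0. Qed.

Lemma chiD x y : chi F (x + y) = chi F x * chi F y.
Proof.
rewrite !chiE -big_split; apply: eq_bigr => A _; rewrite coefRD /=.
by case: (coefR x A) => [[|[|//]] ?]; case: (coefR y A) => [[|[|//]] ?] /=;
  rewrite ?expr0 ?expr1 ?mulrNN ?mulr1 ?mul1r.
Qed.

Lemma chi_sum I (s : seq I) (P : pred I) (f : I -> Rk k) :
  chi F (\sum_(i <- s | P i) f i) = \prod_(i <- s | P i) chi F (f i).
Proof. exact: (big_morph (chi F (k:=k)) chiD chi0). Qed.

(** A suitable monomial carries [x] to the top monomial [basisR setT], whose single nonzero
    coefficient gives the sign -1. *)
Lemma chi_generating x : x != 0 -> exists a, chi F (a * x) = -1.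
Proof.
move=> x0.
have [A0 xA0] : exists A, coefR x A != 0.
  apply/existsP; apply: contraNT x0 => /existsPn h; apply/eqP/RkP => A.
  by rewrite coefR0; apply/eqP; have := h A; rewrite negbK.
(* For A minimal in the support of x, u_(~: A) kills every other monomial of x. *)
have [A xA minA] :=
  @arg_minnP _ A0 (fun A : {set 'I_k} => coefR x A != 0) (fun A => #|A|) xA0.
have vanish (B : {set 'I_k}) : B \proper A -> coefR x B = 0.
  move=> /proper_card ltBA; apply/eqP; apply: contraTT ltBA => /minA.
  by rewrite -leqNgt.
exists (basisR (~: A)).
have -> : basisR (~: A) * x = basisR setT.
  apply/RkP => D; rewrite coefRM coefR_basis.
  rewrite big_mkcond (bigD1 (~: A)) //= big1 ?addr0 => [|B nB]; last first.
    by rewrite coefR_basis (negPf nB) mul0r if_same.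
  rewrite coefR_basis eqxx mul1r; case: ifP => [sAD|]; last first.
    by case: eqP => [->|//]; rewrite subsetT.
  have DAE : D :\: ~: A = D :&: A by rewrite setDE setCK.
  (* Since [~: A \subset D], either [D] is the full set, or [D :&: A] is a proper subset of [A] and
     minimality kills the coefficient. *)
  have [sA|nsA] := boolP (A \subset D).
    rewrite DAE; have -> : D = setT.
      by apply/eqP; rewrite -subTset -(setUCr A) subUset sA.
    rewrite eqxx setTI.
    by case: (coefR x A) xA => [[|[|//]] ?] //= _; apply/val_inj.
  rewrite DAE vanish; last by rewrite properE subsetIr subsetI subxx andbT.
  by case: eqP nsA => [->|//]; rewrite subsetT.
rewrite chiE (bigD1 setT) //= coefR_basis eqxx big1 ?mulr1 // => B nB.
by rewrite coefR_basis (negPf nB).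
Qed.

End Character.

(** * Orthogonality of characters over a linear code *)

Section Duality.

Variables (F : numFieldType) (k b n : nat).
Implicit Types (u v : 'rV[Rk k]_(n * b)) (C : {set 'rV[Rk k]_(n * b)}).

Lemma edotDl u u' v : edot (u + u') v = edot u v + edot u' v.
Proof.
by rewrite /edot -big_split; apply: eq_bigr => j _; rewrite mxE mulrDl.
Qed.

Lemma edotZl a u v : edot (a *: u) v = a * edot u v.
Proof. by rewrite /edot mulr_sumr; apply: eq_bigr => j _; rewrite mxE mulrA. Qed.

(** For [v] outside the dual, [chi_generating] and closure under scaling give a codeword [w] with
    [chi F (edot w v) = -1]; translation by [w] permutes [C] and negates the sum. *)
Lemma sum_chi_dual C v : GRing.submod_closed C ->
  \sum_(u in C) chi F (edot u v) = if v \in dual C then #|C|%:R else 0.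
Proof.
move=> [C0 Clin].
have CD u u' : u \in C -> u' \in C -> u + u' \in C.
  by move=> uC u'C; rewrite -[u]scale1r; apply: Clin.
have CZ a u : u \in C -> a *: u \in C.
  by move=> uC; rewrite -[_ *: _]addr0; apply: Clin.
rewrite inE; case: ifPn => [/forall_inP dv|].
  rewrite (eq_bigr (fun=> 1)) ?sumr_const // => u /dv /eqP ->.
  exact: chi0.
rewrite negb_forall_in => /exists_inP[u0 u0C /(chi_generating F)[a chia]].
have wC : a *: u0 \in C by apply: CZ.
set S := LHS; have : S = - S.
  rewrite {1}/S (reindex_inj (addrI (a *: u0))) /= /S -sumrN.
  apply: eq_big => [u|u _]; last by rewrite edotDl edotZl chiD chia mulN1r.
  apply/idP/idP => [uC|]; last exact: CD.
  by rewrite -[u](addKr (a *: u0)) -scaleN1r CD ?CZ.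
(* Twice the sum is 0, and 2 is nonzero in a [numFieldType]. *)
by move/eqP; rewrite -addr_eq0 -mulr2n mulrn_eq0 /= => /eqP.
Qed.

End Duality.

(** * Counting tuples with a prescribed joint composition *)

Section Count.

Variable I : finType.
Implicit Types (c : seq I) (s : I -> I -> nat).

Lemma big_tuple_cons T (idx : T) (op : Monoid.com_law idx) m (G : seq I -> T) :
  \big[op/idx]_(x : m.+1.-tuple I) G x =
  \big[op/idx]_(q : I) \big[op/idx]_(x : m.-tuple I) G (q :: x).
Proof.
rewrite pair_big (reindex (fun p : I * m.-tuple I => [tuple of p.1 :: p.2])) //=.
exists (fun x : m.+1.-tuple I => (thead x, [tuple of behead x])) => [[q x] _|x _].
  by congr pair; apply/val_inj.
by rewrite -tuple_eta.
Qed.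

Definition has_joint_comp s c x : bool :=
  [forall p, [forall q, count_mem (p, q) (zip c x) == s p q]].

(* The division-free form of the multinomial count; the induction removes the
   first coordinate, which lowers one entry s c0 q by 1. *)
Lemma count_joint_comp c s :
    (forall p, \sum_q s p q = count_mem p c)%N ->
  ((\sum_(x : (size c).-tuple I) has_joint_comp s c x) *
    \prod_p \prod_q (s p q)`! = \prod_p (count_mem p c)`!)%N.
Proof.
elim: c s => [|c0 c IHc] s sE.
  have s0 p q : s p q = 0%N.
    by apply/eqP; move/eqP: (sE p); rewrite sum_nat_eq0 => /forall_inP ->.
  rewrite [X in (X * _)%N](eq_bigr (fun=> 1%N)) => [|x _] /=.
    rewrite sum1_card card_tuple expn0 mul1n.
    by rewrite !big1 // => p _; rewrite big1 // => q _; rewrite s0.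
  suff -> : has_joint_comp s [::] x by [].
  by apply/forallP => p; apply/forallP => q; rewrite s0 tuple0.
rewrite (big_tuple_cons _ _ _ _ (fun x => (has_joint_comp s (c0 :: c) x : nat))).
rewrite big_distrl /=.
(* Tuples with first entry [q] contribute the share [s c0 q]. The shares add up to the number of
   [c0] in [c0 :: c], which is the factor gained by its factorial. *)
transitivity (\sum_q s c0 q * \prod_p (count_mem p c)`!)%N; last first.
  rewrite -big_distrl /= sE /= eqxx add1n [in RHS](bigD1 c0) //= eqxx add1n factS.
  rewrite [X in (_ * X = _)%N](bigD1 c0) //= -mulnA; congr (_ * (_ * _))%N.
  by apply: eq_bigr => p; rewrite eq_sym => /negPf ->.
apply: eq_bigr => q _.
case s0: (s c0 q) => [|m].
  rewrite mul0n big1 // => x _; apply/eqP; rewrite eqb0; apply/forallPn.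
  by exists c0; apply/forallPn; exists q; rewrite /= eqxx s0.
(* The truncated subtraction is exact: the only entry lowered is [s c0 q], which equals [m.+1]. *)
pose s' p' q' := (s p' q' - ((c0, q) == (p', q')))%N.
have sE' p' q' : s p' q' = (((c0, q) == (p', q')) + s' p' q')%N.
  by rewrite subnKC //; case: eqP => // -[<- <-]; rewrite s0.
have s'E p : (\sum_q' s' p q' = count_mem p c)%N.
  have := sE p; rewrite (eq_bigr _ (fun q' _ => sE' p q')) big_split /=.
  rewrite (bigD1 q) //= big1 ?addn0 => [|q' /negPf nq]; last first.
    by rewrite xpair_eqE [q == q']eq_sym nq andbF.
  by rewrite xpair_eqE eqxx andbT => /addnI.
rewrite -(IHc _ s'E) mulnCA; congr (_ * _)%N.
  apply: eq_bigr => x _; congr nat_of_bool.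
  apply: eq_forallb => p; apply: eq_forallb => q'.
  by rewrite /= sE' eqn_add2l.
rewrite (bigD1 c0) //= (bigD1 q) //= [in RHS](bigD1 c0) //= [in RHS](bigD1 q) //=.
rewrite /s' eqxx s0 subn1 factS -!mulnA; congr (_ * (_ * (_ * _)))%N.
  by apply: eq_bigr => q' /negPf nq; rewrite xpair_eqE eqxx eq_sym nq subn0.
apply: eq_bigr => p /negPf np; apply: eq_bigr => q' _.
by rewrite xpair_eqE eq_sym np subn0.
Qed.

Lemma sum_count (V : nmodType) (T : finType) (f : T -> V) (z : seq T) :
  \sum_(w <- z) f w = \sum_w f w *+ count_mem w z.
Proof.
elim: z => [|a z IHz].
  by rewrite big_nil big1 // => w _; rewrite mulr0n.
rewrite big_cons IHz (bigD1 a) //= [in RHS](bigD1 a) //= eqxx mulrS addrA.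
congr (_ + _); apply: eq_bigr => w; rewrite eq_sym => /negPf na.
by rewrite na.
Qed.

Lemma count_joint_row c (x : seq I) p : size x = size c ->
  (\sum_q count_mem (p, q) (zip c x) = count_mem p c)%N.
Proof.
elim: c x => [|c0 c IHc] [|x0 x] //= => [_|[/IHc <-]].
  by rewrite big1.
rewrite big_split /=; congr (_ + _)%N.
rewrite (bigD1 x0) //= big1 ?addn0 => [|q /negPf nq].
  by rewrite xpair_eqE eqxx andbT.
by rewrite xpair_eqE [x0 == q]eq_sym nq andbF.
Qed.

Lemma count_joint_le c (x : seq I) p q : size x = size c ->
  (count_mem (p, q) (zip c x) <= count_mem p c)%N.
Proof.
by move=> xc; rewrite -(count_joint_row _ _ p xc) (bigD1 q) //= leq_addr.
Qed.

(** Tuples are grouped by joint composition, with fibre sizes from [count_joint_comp]. The bound [B]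
    keeps the families in a finite type, and [cB] ensures that [inord] alters no count. *)
Lemma sum_joint_comp (F : numFieldType) (V : lmodType F) m (c : m.-tuple I) B
    (G : {ffun I -> {ffun I -> 'I_B.+1}} -> V) :
    (forall p, count_mem p c <= B)%N ->
  \sum_(x : m.-tuple I)
     G [ffun p => [ffun q => inord (count_mem (p, q) (zip c x))]] =
  \sum_(s : {ffun I -> {ffun I -> 'I_B.+1}}
         | [forall p, (\sum_q s p q)%N == count_mem p c])
     (\prod_p ((count_mem p c)`!%:R / (\prod_q (s p q)`!)%:R)) *: G s.
Proof.
move=> cB.
have row (x : m.-tuple I) p :
  (\sum_q count_mem (p, q) (zip c x) = count_mem p c)%N.
  by apply: count_joint_row; rewrite !size_tuple.
have jcE (x : m.-tuple I) p q : (inord (count_mem (p, q) (zip c x)) : 'I_B.+1) =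
    count_mem (p, q) (zip c x) :> nat.
  rewrite inordK // ltnS (leq_trans _ (cB p)) // count_joint_le //.
  by rewrite !size_tuple.
rewrite (partition_big (fun x : m.-tuple I =>
    [ffun p => [ffun q => inord (count_mem (p, q) (zip c x))]])
  (fun s : {ffun I -> {ffun I -> 'I_B.+1}} =>
    [forall p, (\sum_q s p q)%N == count_mem p c])) /= => [|x _]; last first.
  apply/forallP => p; rewrite -(row x p); apply/eqP/eq_bigr => q _.
  by rewrite !ffunE jcE.
apply: eq_bigr => s /forallP sE.
rewrite (eq_bigr (fun=> G s)) => [|x /eqP -> //].
rewrite sumr_const -scaler_nat; congr (_ *: _).
have := @count_joint_comp c (fun p q => s p q) (fun p => eqP (sE p)).
rewrite size_tuple; set N := (\sum_x _)%N => NE.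
have -> : #|[pred x : m.-tuple I |
     [ffun p => [ffun q => inord (count_mem (p, q) (zip c x))]] == s]| = N.
  rewrite -sum1_card big_mkcond; apply: eq_bigr => x _; rewrite inE.
  suff -> : has_joint_comp (fun p q => s p q) c x =
    ([ffun p => [ffun q => inord (count_mem (p, q) (zip c x))]] == s).
    by case: eqP.
  apply/forallP/eqP => [h|<- p].
    apply/ffunP => p; apply/ffunP => q; rewrite !ffunE; apply/val_inj.
    by rewrite /= jcE; apply/eqP; have /forallP := h p.
  by apply/forallP => q; rewrite !ffunE jcE.
(* The factorials are nonzero in [F], so [NE] can be divided by them. *)
rewrite prodf_div; apply: canRL (mulfK _) _; last first.
  by rewrite -!rmorph_prod -natrM NE.
rewrite -rmorph_prod pnatr_eq0 -lt0n prodn_gt0 // => p.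
by rewrite prodn_gt0 // => q; rewrite fact_gt0.
Qed.

End Count.

(** Serves twice: with values in [Rk k] for the inner product and in [nat] for the Lee weight. *)
Lemma sum_ord_count (V : nmodType) (I : finType) m (f : I -> I -> V)
    (c x : m.-tuple I) :
  \sum_(i < m) f (tnth c i) (tnth x i) =
  \sum_p \sum_q f p q *+ count_mem (p, q) (zip c x).
Proof.
rewrite pair_big -(sum_count V _ (fun w => f w.1 w.2)).
rewrite (big_tuple _ _ [tuple of zip c x]) /=; apply: eq_bigr => i _.
have i0 := tnth c i.
by rewrite !(tnth_nth (i0, i0)) !(tnth_nth i0) nth_zip ?size_tuple.
Qed.

(** * The Fourier transform of a single byte *)

Section Byte.

Variables (F : numFieldType) (k b t l : nat) (r : 'I_l -> Rk k).
Hypothesis (r_bij : bijective r).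
Hypothesis (r_0 : forall p : 'I_l, p = 0%N :> nat -> r p = 0).

Lemma sum_chi_byte (y : 'rV[Rk k]_b) (j : 'I_l -> nat) :
    (forall p, #|[set i | y 0 i == r p]| = j p) ->
  \sum_(x : 'rV[Rk k]_b)
     chi F (\sum_j y 0 j * x 0 j) *: 'X^(ceil_div (lee x) t) =
  gpoly F t r j :> {poly F}.
Proof.
move=> jE.
have [g rK gK] := r_bij.
(* The byte [y] read as a tuple of indices, through the inverse [g] of [r]. *)
pose c := [tuple g (y 0 i) | i < b].
have cE p : j p = count_mem p c.
  rewrite -jE -sum1_card -sum1_count big_tuple; apply: eq_bigl => i.
  by rewrite inE tnth_mktuple /= -(can_eq gK) rK.
rewrite /gpoly; set B := (\max_(p < l) _)%N.
have cB p : (count_mem p c <= B)%N by rewrite -cE (leq_bigmax p).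
rewrite (reindex (fun x : b.-tuple 'I_l => \row_i r (tnth x i))) /=; last first.
  exists (fun x : 'rV_b => [tuple g (x 0 i) | i < b]) => x _.
    by apply: eq_from_tnth => i; rewrite tnth_mktuple mxE rK.
  by apply/rowP => i; rewrite mxE tnth_mktuple gK.
pose G (s : {ffun 'I_l -> {ffun 'I_l -> 'I_B.+1}}) : {poly F} :=
  chi F (\sum_p \sum_q (r p * r q) *+ s p q)
   *: 'X^(ceil_div (\sum_p \sum_(q < l | (0 < q)%N) leeR (r q) * s p q) t).
have -> : \sum_(x : b.-tuple 'I_l)
    chi F (\sum_j y 0 j * (\row_i r (tnth x i)) 0 j)
      *: 'X^(ceil_div (lee (\row_i r (tnth x i))) t) =
  \sum_(x : b.-tuple 'I_l)
     G [ffun p => [ffun q => inord (count_mem (p, q) (zip c x))]].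
  apply: eq_bigr => x _; rewrite /G.
  have jcE p q : (inord (count_mem (p, q) (zip c x)) : 'I_B.+1) =
      count_mem (p, q) (zip c x) :> nat.
    rewrite inordK // ltnS (leq_trans _ (cB p)) // count_joint_le //.
    by rewrite !size_tuple.
  congr (chi F _ *: 'X^(ceil_div _ t)).
    rewrite (eq_bigr (fun i => r (tnth c i) * r (tnth x i))) => [|i _].
      rewrite (sum_ord_count _ _ _ (fun p q => r p * r q)).
      by apply: eq_bigr => p _; apply: eq_bigr => q _; rewrite !ffunE jcE.
    by rewrite mxE tnth_mktuple gK.
  rewrite /lee (eq_bigr (fun i => leeR (r (tnth x i)))) => [|i _]; last first.
    by rewrite mxE.
  rewrite (sum_ord_count nat _ _ (fun p q => leeR (r q)) c x).
  apply: eq_bigr => p _; rewrite [RHS]big_mkcond; apply: eq_bigr => q _.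
  (* The index [q = 0], left out in [gpoly], stands for the zero of the ring, of Lee weight 0. *)
  rewrite !ffunE jcE; case: posnP => [/r_0 ->|_]; first by rewrite leeR0 mul0rn.
  by rewrite -mulr_natr natn.
rewrite (sum_joint_comp _ F _ _ c B G cB); apply: eq_big => [s|s _].
  by apply: eq_forallb => p; rewrite cE.
rewrite /G scalerA; congr (_ *: _); rewrite chi_sum -big_split.
by apply: eq_bigr => p _; rewrite cE.
Qed.

End Byte.

(** * From bytes to vectors, and the MacWilliams identity *)

Section MacWilliams.

Variables (F : numFieldType) (k b n t l : nat) (r : 'I_l -> Rk k).
Hypothesis (r_bij : bijective r).
Hypothesis (r_0 : forall p : 'I_l, p = 0%N :> nat -> r p = 0).
Implicit Types (u v : 'rV[Rk k]_(n * b)).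

Lemma edot_byte u v :
  edot u v = \sum_(i < n) \sum_(j < b) byte u i 0 j * byte v i 0 j.
Proof.
rewrite /edot pair_big (reindex _ (curry_mxvec_bij n b)) /=.
by apply: eq_bigr => -[i j] _; rewrite !mxE.
Qed.

(** Expanding the product of byte sums gives a sum over families of bytes, that is, over vectors;
    [chi] and the power of the indeterminate multiply across bytes. *)
Lemma prod_gpoly u (J : 'I_n -> 'I_l -> nat) :
    (forall i p, byte_comp r u i p = J i p) ->
  \prod_(i < n) gpoly F t r (J i) =
  \sum_v chi F (edot u v) *: 'X^(spotty_lee t v).
Proof.
move=> uJ.
under eq_bigr => i _ do
  rewrite -(sum_chi_byte F k b t l r r_bij r_0 (byte u i) (J i) (uJ i)).
rewrite bigA_distr_bigA /=.
rewrite (reindex (fun v => [ffun i => byte v i])) /=; last first.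
  exists (fun f : {ffun 'I_n -> 'rV_b} => mxvec (\matrix_(i, j) f i 0 j)).
    move=> v _; rewrite -[RHS]vec_mxK; congr mxvec; apply/matrixP => i j.
    by rewrite !mxE ffunE !mxE.
  by move=> f _; apply/ffunP => i; rewrite ffunE /byte mxvecK; apply/rowP => j;
    rewrite !mxE.
apply: eq_bigr => v _; rewrite scaler_prod -prodrXr edot_byte chi_sum.
by congr (_ *: _); apply: eq_bigr => i _; rewrite ffunE.
Qed.

Lemma spotty_macwilliams (C : {set 'rV[Rk k]_(n * b)}) :
    GRing.submod_closed C ->
  spotty_enum F t (dual C) =
  #|C|%:R^-1 *:
    \sum_(J : {ffun 'I_n -> {ffun 'I_l -> 'I_b.+1}})
       (comp_count r C (fun i p => J i p))%:R *:
         \prod_(i < n) gpoly F t r (fun p => J i p).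
Proof.
move=> Clin.
have C_neq0 : #|C|%:R != 0 :> F.
  by rewrite pnatr_eq0 -lt0n; apply/card_gt0P; exists 0; case: Clin.
(* A byte has [b] coordinates, so the range of [J] contains every composition. *)
have comp_ub u i p : (byte_comp r u i p < b.+1)%N.
  by rewrite ltnS (leq_trans (max_card _)) ?card_ord.
pose comp u : {ffun 'I_n -> {ffun 'I_l -> 'I_b.+1}} :=
  [ffun i => [ffun p => inord (byte_comp r u i p)]].
have compE u i p : comp u i p = byte_comp r u i p :> nat.
  by rewrite !ffunE inordK.
apply: (canRL (scalerK _)) => //.
transitivity (\sum_(u in C) \sum_v chi F (edot u v) *: 'X^(spotty_lee t v)).
  rewrite exchange_big /= /spotty_enum scaler_sumr big_mkcond.
  apply: eq_bigr => v _; rewrite -scaler_suml sum_chi_dual //.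
  by case: ifP; rewrite ?scale0r.
rewrite (partition_big comp predT) //=; apply: eq_bigr => J _.
(* The transform at [u] depends only on the composition of [u], so the fibre over [J] consists of
   [comp_count] equal terms. *)
rewrite (eq_bigr (fun=> \prod_(i < n) gpoly F t r (fun p => J i p))).
  rewrite sumr_const scaler_nat; congr (_ *+ _); rewrite /comp_count.
  apply: eq_card => u; rewrite !inE; congr (_ && _).
  apply/eqP/forallP => [<- i|h]; first by apply/forallP => p; rewrite compE.
  apply/ffunP => i; apply/ffunP => p; apply/val_inj.
  by rewrite /= compE; apply/eqP; have /forallP := h i.
move=> u /andP[_ /eqP <-].
by rewrite -(prod_gpoly u (fun i p => comp u i p)) // => i p; rewrite compE.
Qed.

End MacWilliams.

(* R[i] is the field of complex numbers; the two sides are polynomials in the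
   indeterminate z. *)
Theorem theorem6p7 (R : realType) (k b n t : nat)
    (k_ge1 : (1 <= k)%N) (b_ge1 : (1 <= b)%N) (n_ge1 : (1 <= n)%N)
    (t_ge1 : (1 <= t)%N)
    (r : 'I_(2 ^ 2 ^ k) -> Rk k)
    (r_bij : bijective r)
    (r_0 : forall p : 'I_(2 ^ 2 ^ k), p = 0%N :> nat -> r p = 0)
    (C : {set 'rV[Rk k]_(n * b)})
    (C_linear : GRing.submod_closed C) :
  spotty_enum R[i] t (dual C) =
  (#|C|%:R : R[i])^-1 *:
    \sum_(J : {ffun 'I_n -> {ffun 'I_(2 ^ 2 ^ k) -> 'I_b.+1}})
       (comp_count r C (fun i p => J i p))%:R *:
         \prod_(i < n) gpoly R[i] t r (fun p => J i p).
Proof. exact: spotty_macwilliams. Qed.
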